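(* Consider any one of FS, LAR, or lasso run for $k$ steps. Fix any model $M\in\mathcal M$, a pivot value $\mu\in\mathbb R$, and suppose that $v$ is chosen so that $v^Ty$ is a normalized coefficient from projecting $y$ onto a subset of the variables in $X$, i.e. $v=X_A(X_A^TX_A)^{-1}e_j\big/\sqrt{e_j^T(X_A^TX_A)^{-1}e_j}$ for a fixed subset $A\subseteq\{1,\dots,d\}$ and index $j$. Then the TG statistic depends on $(X,y)$ only through $\Omega_n=\big(\frac1nX^TX,\frac1{\sqrt n}X^Ty\big)$, so that one may write $$T(X,y;M,v,\mu)=\psi_M\Big(\frac1nX^TX,\frac1{\sqrt n}X^Ty\Big)$$ for a function $\psi_M$. Further, $\psi_M$ is continuous at any point $(S,z)$ such that $S$ is nonsingular and $P_M(S)\,z>0$ (componentwise).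
   Context: **Setup.** $X\in\mathbb R^{n\times d}$ has columns $X_1,\dots,X_d$; $y\in\mathbb R^n$; $k\ge 1$ is a fixed number of steps. For an ordered list $A$ of distinct indices, $X_A$ is the matrix with these columns and $P_A^\perp=I-X_A(X_A^TX_A)^{-1}X_A^T$ ($=I$ if $A=\emptyset$). All inverses and reciprocals written below are assumed to exist. Inequalities between vectors are componentwise. **Procedures and selected models.** Each procedure starts from $A_0=\emptyset$ and produces active lists $A_1,\dots,A_k$ and sign vectors $s_\ell\in\{-1,1\}^{|A_\ell|}$, which are the signs of the least squares coefficients on the active variables: $\mathrm{diag}(s_\ell)(X_{A_\ell}^TX_{A_\ell})^{-1}X_{A_\ell}^Ty\ge 0$, $\ell=1,\dots,k$. *FS (forward stepwise).* $A_\ell=(A_{\ell-1},j_\ell)$ where $j_\ell\notin A_{\ell-1}$ satisfies, with $P=P^\perp_{A_{\ell-1}}$ and $s_{\ell,\ell}$ the last entry of $s_\ell$, $s_{\ell,\ell}\,X_{j_\ell}^TPy/\|PX_{j_\ell}\|_2^2\ \ge\ \pm X_j^TPy/\|PX_j\|_2^2$ for all $j\notin A_\ell$. The model is $M=\{(A_\ell,s_\ell):\ell=1,\dots,k\}$. *LAR (least angle regression).* One also tracks entry signs $\sigma_{\ell}\in\{-1,1\}^{|A_\ell|}$ and knots $\lambda_0=+\infty\ge\lambda_1\ge\cdots\ge\lambda_k\ge0$. At step $\ell$, with $A=A_{\ell-1}$, $\sigma=\sigma_{\ell-1}$ (sign vector), put, for $j\notin A$ and $s\in\{-1,1\}$,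 $c_\ell(j,s)=P_A^\perp X_j/\big(s-X_j^TX_A(X_A^TX_A)^{-1}\sigma\big)$. The eligible pairs are those $(j,s)$ with $c_\ell(j,s)^Ty\le\lambda_{\ell-1}$ (ineligible ones satisfy $\ge$); the pair $(j_\ell,s'_\ell)$ maximizing $c_\ell(j,s)^Ty$ over eligible pairs enters, $\lambda_\ell$ is this maximum, $A_\ell=(A,j_\ell)$, $\sigma_\ell=(\sigma,s'_\ell)$. The extra information $I_\ell$ is the set of eligible pairs together with the entering pair. The model is $M=\{(A_\ell,s_\ell,I_\ell):\ell=1,\dots,k\}$. *Lasso.* As LAR, but at step $\ell$ there are also crossing candidates $j\in A=A_{\ell-1}$ with $d_\ell(j)=X_A(X_A^TX_A)^{-1}e_j/\big(e_j^T(X_A^TX_A)^{-1}\sigma\big)$ ($e_j$ the basis vector at the position of $j$ in $A$), eligible if $d_\ell(j)^Ty\le\lambda_{\ell-1}$ (ineligible ones satisfy $\ge$). A variable that joined at step $\ell-1$ is not a crossing candidate at step $\ell$, and a variable that left at step $\ell-1$ is not a joining candidate at step $\ell$ with the sign it had. $\lambda_\ell\ge 0$ is the maximum of all eligible $c_\ell(j,s)^Ty$ and $d_\ell(j)^Ty$; if attained by a joining pair it is appended, if attained by a crossing variable that variable and its sign are removed. $I_\ell$ is the set of eligible joining pairs, the set of eligible crossing variables, and the event (join/leave) that occurs. The model is $M=\{(A_\ell,s_\ell,I_\ell)\}_{\ell=1}^k$. **Selection event.** $\mathcal M$ is the finite set of possible models. For fixed $M$ all the conditions above are linear inequalities in $y$;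 $\hat M(X,y)=M$ means that all of these (weak) inequalities hold. $Q_M(X)$ is the matrix whose rows give these inequalities (identically zero rows omitted; rows matter only up to positive scaling), so $\hat M(X,y)=M\iff Q_M(X)y\ge0$. The inequalities involve $(X,y)$ only through $X^TX$ and $X^Ty$; $P_M(S)$, for a symmetric positive definite $d\times d$ matrix $S$, is the matrix such that $P_M(S)z$ is the vector of left-hand sides after replacing $X_i^TX_j$ by $S_{ij}$ and $X_j^Ty$ by $z_j$. Thus $\hat M(X,y)=M\iff P_M(\frac1nX^TX)\frac1{\sqrt n}X^Ty\ge0$, with $Q_M(X)=P_M(\frac1nX^TX)\frac1{\sqrt n}X^T$. **TG (truncated Gaussian) statistic.** Fix known $\sigma>0$ (noise level) and let $\Phi$ be the standard normal CDF. For $v\in\mathbb R^n\setminus\{0\}$, $\mu\in\mathbb R$ and $y$ with $\hat M(X,y)=M$, put $w=Q_M(X)v/\|v\|_2^2$, $$a=v^Ty-\min_{i:w_i>0}\frac{(Q_M(X)y)_i}{w_i},\qquad b=v^Ty-\max_{i:w_i<0}\frac{(Q_M(X)y)_i}{w_i}$$ ($\min\emptyset=+\infty$, $\max\emptyset=-\infty$), and $$T(X,y;M,v,\mu)=\frac{\Phi\big(\frac{b-\mu}{\sigma\|v\|_2}\big)-\Phi\big(\frac{v^Ty-\mu}{\sigma\|v\|_2}\big)}{\Phi\big(\frac{b-\mu}{\sigma\|v\|_2}\big)-\Phi\big(\frac{a-\mu}{\sigma\|v\|_2}\big)}.$$ The function $\psi_M$ may depend on the fixed objects $M,A,j,\mu,\sigma$.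 *)

(* Defs.v *)
From HB Require Import structures.
From mathcomp Require Import all_boot all_order all_algebra.
From mathcomp Require Import all_classical all_reals all_analysis.

Set Implicit Arguments.
Unset Strict Implicit.
Unset Printing Implicit Defensive.

Import Order.TTheory GRing.Theory Num.Theory.
Import numFieldNormedType.Exports.

Local Open Scope ring_scope.

(* A sign in {-1, 1} is a boolean, with true standing for 1. *)
Definition sgn {R : pzRingType} (s : bool) : R := if s then 1 else -1.

Definition sgnv {R : pzRingType} (p : nat) (s : seq bool) : 'cV[R]_p :=
  \col_(i < p) sgn (nth true s i).

Definition dot {R : pzRingType} (n : nat) (u v : 'cV[R]_n) : R :=
  (u^T *m v) 0 0.

Definition norm2 {R : rcfType} (n : nat) (u : 'cV[R]_n) : R :=
  Num.sqrt (dot u u).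

(* The basis vector e_j at the position of j in the duplicate-free list A. *)
Definition bvec {R : pzRingType} (d : nat) (A : seq 'I_d) (j : 'I_d) :
    'cV[R]_(size A) :=
  \col_(i < size A) (tnth (in_tuple A) i == j)%:R.

Definition rowsmx {R : pzRingType} (m : nat) (rs : seq 'rV[R]_m) :
    'M[R]_(size rs, m) :=
  \matrix_(i < size rs) nth 0 rs i.

(* The quantities from which the selection inequalities are assembled.  A row
   vector of width m stands for a linear functional.  There are two readings:
   [design_data X], where m = n and functionals act on y, and [gram_data S],
   where m = d and functionals act on z, obtained from the former by replacing
   X_i^T X_j by S_ij and X_j^T y by z_j. *)
Record step_data (R : realType) (d m : nat) := StepData {
  sd_gram  : forall A : seq 'I_d, 'M[R]_(size A);          (* X_A^T X_A *)
  sd_cross : 'I_d -> forall A : seq 'I_d, 'rV[R]_(size A); (* X_j^T X_A *)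
  (* e_j^T (X_A^T X_A)^-1 X_A^T *)
  sd_coef  : seq 'I_d -> 'I_d -> 'rV[R]_m;
  (* X_j^T P_A^perp *)
  sd_resid : seq 'I_d -> 'I_d -> 'rV[R]_m;
  (* || P_A^perp X_j ||_2^2 *)
  sd_rss   : seq 'I_d -> 'I_d -> R
}.

Section DesignData.
Context {R : realType} {n d : nat}.
Variable X : 'M[R]_(n, d).

Definition cols (A : seq 'I_d) : 'M[R]_(n, size A) :=
  colsub (tnth (in_tuple A)) X.

Definition gram (A : seq 'I_d) : 'M[R]_(size A) := (cols A)^T *m cols A.

Definition proj_perp (A : seq 'I_d) : 'M[R]_n :=
  1%:M - cols A *m invmx (gram A) *m (cols A)^T.

Definition coef_vec (A : seq 'I_d) (j : 'I_d) : 'cV[R]_n :=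
  cols A *m invmx (gram A) *m bvec A j.

Definition design_data : step_data R d n := {|
  sd_gram  := gram;
  sd_cross := fun j A => (col j X)^T *m cols A;
  sd_coef  := fun A j => (coef_vec A j)^T;
  sd_resid := fun A j => (col j X)^T *m proj_perp A;
  sd_rss   := fun A j => norm2 (proj_perp A *m col j X) ^+ 2
|}.

(* The direction v for which v^T y is the normalized coefficient of variable j
   in the projection of y onto the variables in A. *)
Definition coef_dir (A : seq 'I_d) (j : 'I_d) : 'cV[R]_n :=
  (Num.sqrt (((bvec A j)^T *m invmx (gram A) *m bvec A j) 0 0))^-1
    *: coef_vec A j.

End DesignData.

Section GramData.
Context {R : realType} {d : nat}.
Variable S : 'M[R]_d.

Definition subgram (A B : seq 'I_d) : 'M[R]_(size A, size B) :=
  mxsub (tnth (in_tuple A)) (tnth (in_tuple B)) S.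

Definition subcross (j : 'I_d) (A : seq 'I_d) : 'rV[R]_(size A) :=
  \row_(i < size A) S j (tnth (in_tuple A) i).

(* z |-> z_A, the replacement of y |-> X_A^T y *)
Definition restr (A : seq 'I_d) : 'M[R]_(size A, d) :=
  rowsub (tnth (in_tuple A)) 1%:M.

Definition gram_data : step_data R d d := {|
  sd_gram  := fun A => subgram A A;
  sd_cross := subcross;
  sd_coef  := fun A j => (bvec A j)^T *m invmx (subgram A A) *m restr A;
  sd_resid := fun A j =>
    delta_mx 0 j - subcross j A *m invmx (subgram A A) *m restr A;
  (* || P X_j ||^2 = X_j^T X_j - X_j^T X_A (X_A^T X_A)^-1 X_A^T X_j *)
  sd_rss   := fun A j =>
    S j j - (subcross j A *m invmx (subgram A A) *m (subcross j A)^T) 0 0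
|}.

End GramData.

(* A model is the sequence, over the k steps, of what the procedure selects.
   The active lists A_1, ..., A_k are not stored: they are determined by the
   successive variables entering or leaving. *)

Record fs_step (d : nat) := FSStep {
  fs_var : 'I_d;        (* entering variable j_l *)
  fs_sgn : seq bool     (* s_l *)
}.

(* inl (j, s): variable j joins with sign s; inr j: variable j leaves. *)
Definition event (d : nat) : finType := (('I_d * bool) + 'I_d)%type.

Record path_step (d : nat) := PathStep {
  ps_event : event d;          (* what occurs at this step *)
  ps_elig  : {set event d};    (* eligible joining pairs, crossing variables *)
  ps_sgn   : seq bool          (* s_l *)
}.

Inductive model (d k : nat) :=
| FS of k.-tuple (fs_step d)
| LAR of k.-tuple (path_step d)
| Lasso of k.-tuple (path_step d).

Section Candidates.
Context {d : nat}.

(* The current active list A and its entry signs sigma are kept together as a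
   list a of pairs: A = unzip1 a and sigma = unzip2 a. *)
Implicit Types (a : seq ('I_d * bool)) (banned : seq (event d)).

Definition join_cands a : seq (event d) :=
  [seq inl (j, s) | j <- [seq i <- enum 'I_d | i \notin unzip1 a],
                    s <- [:: true; false]].

Definition cross_cands a : seq (event d) := [seq inr j | j <- unzip1 a].

(* [cross] is false for LAR and true for the lasso *)
Definition cands (cross : bool) a banned : seq (event d) :=
  [seq e <- join_cands a ++ (if cross then cross_cands a else [::])
     | e \notin banned].

Definition update a (e : event d) : seq ('I_d * bool) :=
  match e with
  | inl p => rcons a p
  | inr j => [seq p <- a | p.1 != j]
  end.

(* What may not happen right after e: a variable that just joined does not
   leave, one that just left does not rejoin with the sign it had. *)
Definition ban a (e : event d) : seq (event d) :=
  match e with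
  | inl p => [:: inr p.1]
  | inr j => [seq inl p | p <- a & p.1 == j]
  end.

End Candidates.

(* Models that are combinatorially consistent. *)

Fixpoint fs_possible (d : nat) (A : seq 'I_d) (st : seq (fs_step d)) : bool :=
  if st is q :: st' then
    let B := rcons A (fs_var q) in
    [&& fs_var q \notin A, size (fs_sgn q) == size B & fs_possible B st']
  else true.

(* [first] holds at step 1 only: since lambda_0 = +oo, all candidates are
   eligible there. *)
Fixpoint path_possible (d : nat) (cross first : bool) (a : seq ('I_d * bool))
    (banned : seq (event d)) (st : seq (path_step d)) : bool :=
  if st is q :: st' then
    let c := cands cross a banned in
    let b := update a (ps_event q) in
    [&& [forall e in ps_elig q, e \in c],
        first ==> all [in ps_elig q] c,
        ps_event q \in ps_elig q,
        size (ps_sgn q) == size b &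
        path_possible cross false b (ban a (ps_event q)) st']
  else true.

Definition possible (d k : nat) (M : model d k) : bool :=
  match M with
  | FS st => fs_possible [::] st
  | LAR st => path_possible false true [::] [::] st
  | Lasso st => path_possible true true [::] [::] st
  end.

Section Inequalities.
Context {R : realType} {d m : nat}.
Variable D : step_data R d m.

(* Rows r such that the inequalities read r . y >= 0. *)

(* diag(s) (X_A^T X_A)^-1 X_A^T y >= 0 *)
Definition sign_rows (A : seq 'I_d) (s : seq bool) : seq 'rV[R]_m :=
  [seq sgn p.2 *: sd_coef D A p.1 | p <- zip A s].

Definition fs_score (A : seq 'I_d) (j : 'I_d) : 'rV[R]_m :=
  (sd_rss D A j)^-1 *: sd_resid D A j.

Definition fs_step_rows (A : seq 'I_d) (q : fs_step d) : seq 'rV[R]_m :=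
  let B := rcons A (fs_var q) in
  [seq sgn (last true (fs_sgn q)) *: fs_score A (fs_var q)
         - sgn t *: fs_score A j
     | j <- [seq i <- enum 'I_d | i \notin B], t <- [:: true; false]]
  ++ sign_rows B (fs_sgn q).

Fixpoint fs_rows (A : seq 'I_d) (st : seq (fs_step d)) : seq 'rV[R]_m :=
  if st is q :: st' then
    fs_step_rows A q ++ fs_rows (rcons A (fs_var q)) st'
  else [::].

(* The denominators of c_l(j, s) and d_l(j). *)
Definition knot_den (a : seq ('I_d * bool)) (e : event d) : R :=
  let A := unzip1 a in
  let sigma := sgnv (size A) (unzip2 a) in
  match e with
  | inl (j, s) =>
      sgn s - (sd_cross D j A *m invmx (sd_gram D A) *m sigma) 0 0
  | inr j => ((bvec A j)^T *m invmx (sd_gram D A) *m sigma) 0 0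
  end.

(* c_l(j, s)^T for a joining pair, d_l(j)^T for a crossing variable *)
Definition knot (a : seq ('I_d * bool)) (e : event d) : 'rV[R]_m :=
  (knot_den a e)^-1 *:
  match e with
  | inl (j, _) => sd_resid D (unzip1 a) j
  | inr j => sd_coef D (unzip1 a) j
  end.

(* [prev] is the functional giving lambda_(l-1), or None if it is +oo.
   The comparison of the occurring event with itself, an identically zero row,
   is left out. *)
Definition knot_rows (prev : option 'rV[R]_m) (c : seq (event d))
    (a : seq ('I_d * bool)) (q : path_step d) : seq 'rV[R]_m :=
  let lambda := knot a (ps_event q) in
  (if prev is Some l then
     [seq if e \in ps_elig q then l - knot a e else knot a e - l | e <- c]
   else [::])
  ++ [seq lambda - knot a e
        | e <- c & (e \in ps_elig q) && (e != ps_event q)]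
  ++ [:: lambda].

Fixpoint path_rows (cross : bool) (prev : option 'rV[R]_m)
    (a : seq ('I_d * bool)) (banned : seq (event d))
    (st : seq (path_step d)) : seq 'rV[R]_m :=
  if st is q :: st' then
    let b := update a (ps_event q) in
    knot_rows prev (cands cross a banned) a q
    ++ sign_rows (unzip1 b) (ps_sgn q)
    ++ path_rows cross (Some (knot a (ps_event q))) b (ban a (ps_event q)) st'
  else [::].

Definition model_rows (k : nat) (M : model d k) : seq 'rV[R]_m :=
  match M with
  | FS st => fs_rows [::] st
  | LAR st => path_rows false None [::] [::] st
  | Lasso st => path_rows true None [::] [::] st
  end.

(* Existence of the inverses and reciprocals occurring in the rows. *)

Fixpoint fs_defined (A : seq 'I_d) (st : seq (fs_step d)) : Prop :=
  if st is q :: st' then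
    let B := rcons A (fs_var q) in
    [/\ forall j, j \notin A -> sd_rss D A j != 0,
        sd_gram D B \in unitmx &
        fs_defined B st']
  else True.

Fixpoint path_defined (cross : bool) (a : seq ('I_d * bool))
    (banned : seq (event d)) (st : seq (path_step d)) : Prop :=
  if st is q :: st' then
    let b := update a (ps_event q) in
    [/\ forall e, e \in cands cross a banned -> knot_den a e != 0,
        sd_gram D (unzip1 b) \in unitmx &
        path_defined cross b (ban a (ps_event q)) st']
  else True.

Definition model_defined (k : nat) (M : model d k) : Prop :=
  match M with
  | FS st => fs_defined [::] st
  | LAR st => path_defined false [::] [::] st
  | Lasso st => path_defined true [::] [::] st
  end.

End Inequalities.

Definition Qmx {R : realType} {n d k : nat} (M : model d k)
    (X : 'M[R]_(n, d)) := rowsmx (model_rows (design_data X) M).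

Definition Pmx {R : realType} {d k : nat} (M : model d k) (S : 'M[R]_d) :=
  rowsmx (model_rows (gram_data S) M).

(* The event that the procedure, run on (X, y), selects M. *)
Definition selects {R : realType} {n d k : nat} (M : model d k)
    (X : 'M[R]_(n, d)) (y : 'cV[R]_n) : Prop :=
  forall i, 0 <= (Qmx M X *m y) i 0.

(* The standard normal CDF, extended by 0 at -oo and 1 at +oo. *)
Definition Phi {R : realType} (x : \bar R) : R :=
  fine (normal_prob 0 1 [set t : R | (t%:E <= x)%E]%classic).

Definition TG {R : realType} {n d k : nat} (sigma : R) (X : 'M[R]_(n, d))
    (y : 'cV[R]_n) (M : model d k) (v : 'cV[R]_n) (mu : R) : R :=
  let Q := Qmx M X in
  let w : 'cV[R]_(_) := (norm2 v ^+ 2)^-1 *: (Q *m v) in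
  let vy := dot v y in
  let ratio i := ((Q *m y) i 0 / w i 0)%:E in
  let a := (vy%:E - \big[Order.min/+oo]_(i | (0 < w i 0)%R) ratio i)%E in
  let b := (vy%:E - \big[Order.max/-oo]_(i | (w i 0 < 0)%R) ratio i)%E in
  let std t := ((t - mu%:E) * (sigma * norm2 v)^-1%:E)%E in
  (Phi (std b) - Phi (std vy%:E)) / (Phi (std b) - Phi (std a)).

(* Main.v *)
(* For fixed M, the endpoints a and b enter T only through Phi, which is
   monotone, so Phi at the standardized a is the maximum over the rows i with
   w_i > 0 of Phi((v^T y - (Q y)_i / w_i - mu) / sigma), and 0 if there is none.
   Where (Q y)_i > 0, such a term tends to 0 as w_i tends to 0 from above, so
   extending it by 0 to w_i <= 0 keeps it continuous: it does no harm that the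
   index set {i : w_i > 0} varies with S.  The terms for b are extended by 1.
   The denominator does not vanish, since (Q y)_i > 0 gives a < v^T y < b.
   That T is a function of (X^T X / n, X^T y / sqrt n) holds because the rows of
   P_M(S), read as functionals of y, are those of Q_M(X) up to positive factors,
   which cancel in the ratios (Q y)_i / w_i. *)
From HB Require Import structures.
Require Import Defs.
From mathcomp Require Import all_boot all_order all_algebra.
From mathcomp Require Import all_classical all_reals all_analysis.
From mathcomp Require Import measurable_realfun ring lra.
Set Implicit Arguments.
Unset Strict Implicit.
Unset Printing Implicit Defensive.
Import Order.TTheory GRing.Theory Num.Theory.
Import numFieldNormedType.Exports.
Local Open Scope ring_scope.

(** * The standard normal CDF: monotonicity, continuity and limits *)

Section NormalCDF.
Context {R : realType}.
Implicit Types x y : R.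

Lemma Phi_itv x : Phi x%:E = fine (normal_prob 0 1 (`]-oo, x]%classic : set R)).
Proof. by []. Qed.

Lemma PhiNy : Phi (-oo%E : \bar R) = 0.
Proof.
rewrite /Phi (_ : [set _ | _]%classic = set0) ?measure0//.
by apply/seteqP; split=> t //=; rewrite leeNy_eq.
Qed.

Lemma Phiy : Phi (+oo%E : \bar R) = 1.
Proof.
rewrite /Phi (_ : [set _ | _]%classic = setT) ?probability_setT//.
by apply/seteqP; split=> t //= _; rewrite leey.
Qed.

Lemma PhiB x y : x <= y ->
  Phi y%:E - Phi x%:E = fine (normal_prob 0 1 (`]x, y]%classic : set R)).
Proof.
move=> xy; rewrite !Phi_itv.
rewrite (@itv_bndbnd_setU _ _ -oo%O (BRight x) (BRight y))//=.
rewrite measureU//=; last first.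
  apply/seteqP; split=> t //=; rewrite !in_itv/= => -[tx /andP[]].
  by rewrite ltNge tx.
by rewrite fineD ?fin_num_measure//= addrAC subrr add0r.
Qed.

(** The density never exceeds its peak, so its integral over an interval is at most peak times
    length. *)
Lemma Phi_lipschitz x y : x <= y ->
  Phi y%:E - Phi x%:E <= normal_peak 1 * (y - x).
Proof.
move=> xy; rewrite PhiB// -lee_fin fineK ?fin_num_measure//.
rewrite /normal_prob.
apply: (@le_trans _ _
  (\int[lebesgue_measure]_(t in `]x, y]%classic) (normal_peak 1)%:E)%E).
  apply: ge0_le_integral => //=.
  - by move=> t _; rewrite lee_fin normal_pdf_ge0.
  - apply: measurable_funTS.
    apply/measurable_EFinP; exact: measurable_normal_pdf.
  - by move=> t _; rewrite lee_fin normal_pdf_ub ?oner_neq0.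
rewrite integral_cst//= lebesgue_measure_itv/= lte_fin.
case: ltP => _; rewrite ?mule0 ?lee_fin ?EFinM//.
by rewrite mulr_ge0 ?normal_peak_ge0 ?subr_ge0.
Qed.

Lemma Phi_strict_mono x y : x < y -> Phi x%:E < Phi y%:E.
Proof.
move=> xy; rewrite -subr_gt0 PhiB ?ltW// -lte_fin fineK ?fin_num_measure//.
(* Every t between x and y has [|t| <= b], so the density there is at least its value c at b, which
   is positive. *)
pose b : R := Num.max `|x| `|y|.
pose c : R := normal_peak 1 * expR (- b ^+ 2 / 2).
have c0 : 0 < c by rewrite mulr_gt0 ?expR_gt0// normal_peak_gt0 ?oner_neq0.
rewrite /normal_prob.
apply: (@lt_le_trans _ _
  (\int[lebesgue_measure]_(t in `]x, y]%classic) c%:E)%E).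
  rewrite integral_cst//= lebesgue_measure_itv/= lte_fin xy.
  by rewrite -EFinB -EFinM lte_fin mulr_gt0 ?subr_gt0.
apply: ge0_le_integral => //=.
- by move=> t _; rewrite lee_fin ltW.
- apply: measurable_funTS.
    apply/measurable_EFinP; exact: measurable_normal_pdf.
- move=> t; rewrite in_itv/= lee_fin => /andP[xt ty].
  rewrite normal_pdfE ?oner_neq0// ler_pM2l ?normal_peak_gt0 ?oner_neq0//.
  rewrite /normal_fun ler_expR expr1n subr0 !mulNr lerN2 ler_pM2r ?invr_gt0//.
  rewrite -(real_normK (num_real t)) ler_sqr ?nnegrE ?normr_ge0//.
    rewrite /b le_max; have [t0|t0] := leP 0 t.
      by rewrite (ger0_norm t0) (ger0_norm (le_trans t0 ty)) ty orbT.
    have x0 := lt_trans xt t0; rewrite (ltr0_norm t0) (ltr0_norm x0).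
    by rewrite lerN2 ltW.
  by rewrite /b le_max normr_ge0.
Qed.

Lemma Phi_ge0 (t : \bar R) : 0 <= Phi t.
Proof. by rewrite /Phi fine_ge0. Qed.

Lemma Phi_le1 (t : \bar R) : Phi t <= 1.
Proof. 
case: t => [x||]; last by rewrite PhiNy.
  by rewrite Phi_itv -lee_fin fineK ?fin_num_measure// probability_le1.
by rewrite Phiy.
Qed.

Lemma Phi_mono : {homo (@Phi R) : s t / (s <= t)%E >-> s <= t}.
Proof.
move=> [x||] [y||] //; rewrite ?lee_fin ?Phiy ?PhiNy ?Phi_ge0 ?Phi_le1 ?ler01//.
by rewrite le_eqVlt => /predU1P[->//|/Phi_strict_mono/ltW].
Qed.

Lemma Phi_gt0 x : 0 < Phi x%:E.
Proof.
by apply: (le_lt_trans (Phi_ge0 (x - 1)%:E)); rewrite Phi_strict_mono// gtrBl.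
Qed.

Lemma Phi_lt1 x : Phi x%:E < 1.
Proof.
apply: (lt_le_trans _ (Phi_le1 (x + 1)%:E)).
by rewrite Phi_strict_mono// ltrDl.
Qed.

Lemma continuous_Phi : continuous (fun x => Phi x%:E).
Proof.
move=> x; apply/cvgrPdist_lt => e e0.
have p0 : 0 < normal_peak (1 : R) by rewrite normal_peak_gt0 ?oner_neq0.
near=> y.
suff: `|Phi x%:E - Phi y%:E| <= normal_peak 1 * `|x - y|.
  move=> /le_lt_trans; apply; rewrite mulrC -ltr_pdivlMr//.
  by near: y; apply: cvgr_dist_lt; [exact: cvg_id|exact: divr_gt0].
have [xy|/ltW yx] := leP x y.
  rewrite distrC (distrC x) !ger0_norm ?subr_ge0//; first exact: Phi_lipschitz.
  by rewrite Phi_mono// lee_fin.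
rewrite !ger0_norm ?subr_ge0//; first exact: Phi_lipschitz.
by rewrite Phi_mono// lee_fin.
Unshelve. all: by end_near. Qed.

(** The identity, seen as a random variable under the standard normal law, has [Phi] as its CDF;
    this gives access to the limits of CDFs at infinity. *)
Let idTR : measurableTypeR R -> R := idfun.

#[local] HB.instance Definition _ :=
  @isMeasurableFun.Build _ _ _ _ idTR (@measurable_id _ _ setT).

Let X : {RV (@normal_prob R 0 1) >-> R} := idTR.

Lemma Phi_cvgNy (e : R) : 0 < e -> exists K : R, Phi K%:E < e.
Proof.
move=> e0; have /fine_cvgP[_] := cvg_cdfNy0 X.
(* The bound holds strictly below K, hence the shift by 1. *)
move=> /cvgr_lt/(_ e e0)[K [_ h]]; exists (K - 1).
by apply: (h (K - 1)); rewrite gtrBl.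
Qed.

Lemma Phi_cvgy (e : R) : e < 1 -> exists K : R, e < Phi K%:E.
Proof.
move=> e1; have /fine_cvgP[_] := cvg_cdfy1 X.
move=> /cvgr_gt/(_ e e1)[K [_ h]]; exists (K + 1).
by apply: (h (K + 1)); rewrite ltrDl.
Qed.

End NormalCDF.

(** * Single-row truncation terms and their limits *)

Definition lower_term {R : realType} (mu tau x c w : R) : R :=
  if 0 < w then Phi ((x - c / w - mu) * tau)%:E else 0.

Definition upper_term {R : realType} (mu tau x c w : R) : R :=
  if w < 0 then Phi ((x - c / w - mu) * tau)%:E else 1.

Section TruncationTerms.
Context {R : realType} {T : Type} {F : set_system T} {FF : Filter F}.
Variables (mu tau : R) (fx fc fw : T -> R) (x c w : R).
Hypothesis tau0 : 0 < tau.
Hypothesis c0 : 0 < c.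
Hypothesis cvgx : (fx t @[t --> F] --> x)%classic.
Hypothesis cvgc : (fc t @[t --> F] --> c)%classic.
Hypothesis cvgw : (fw t @[t --> F] --> w)%classic.

Lemma cvg_Phi_ratio : w != 0 ->
  (Phi ((fx t - fc t / fw t - mu) * tau)%:E @[t --> F] -->
   Phi ((x - c / w - mu) * tau)%:E)%classic.
Proof.
move=> w0; apply: (cvg_comp (fun t => (fx t - fc t / fw t - mu) * tau)
  (fun u => Phi u%:E)); last exact: continuous_Phi.
apply: cvgM; last exact: cvg_cst.
apply: (@cvgB _ R^o); last exact: cvg_cst.
by apply: (@cvgB _ R^o) => //; apply: cvgM => //; exact: cvgV.
Qed.

(** The numerator stays away from 0 while the denominator tends to 0, so the ratio exceeds any
    bound. Positivity of [fw t] is a premise under the filter because [fw] may approach 0 from both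
    sides. *)
Lemma ratio_lt : w = 0 -> forall K : R,
  \forall t \near F, 0 < fw t -> (fx t - fc t / fw t - mu) * tau < K.
Proof.
move=> w0 K.
(* Once [fx t < x + 1], a ratio above m pushes the argument below K; the 1 in the maximum makes m a
   legitimate divisor. *)
pose m := Num.max 1 (x + 1 - mu - K / tau).
have m0 : 0 < m by rewrite /m lt_max ltr01.
near=> t => wt.
rewrite -ltr_pdivlMr//.
have : x + 1 - mu - K / tau <= m by rewrite /m le_max lexx orbT.
have : fx t < x + 1 by near: t; apply: (cvgr_lt _ cvgx); rewrite ltrDl.
suff : m < fc t / fw t by lra.
(* Eventually [m * fw t] is below [c / 2] and [fc t] is above it. *)
rewrite ltr_pdivlMr//; apply: (@lt_trans _ _ (c / 2)).
  rewrite mulrC -ltr_pdivlMr//.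
  by near: t; apply: (cvgr_lt _ cvgw); rewrite w0 divr_gt0// divr_gt0.
near: t; apply: (cvgr_gt _ cvgc).
by rewrite ltr_pdivrMr// ltr_pMr// ltr1n.
Unshelve. all: by end_near. Qed.

End TruncationTerms.

Section TruncationTermsCvg.
Context {R : realType} {T : Type} {F : set_system T} {FF : Filter F}.
Variables (mu tau : R) (fx fc fw : T -> R) (x c w : R).
Hypothesis tau0 : 0 < tau.
Hypothesis c0 : 0 < c.
Hypothesis cvgx : (fx t @[t --> F] --> x)%classic.
Hypothesis cvgc : (fc t @[t --> F] --> c)%classic.
Hypothesis cvgw : (fw t @[t --> F] --> w)%classic.

(** For w > 0 this is continuity of the ratio, and for w < 0 the term is eventually constant. At w =
    0 the term is either 0 or [Phi] at an argument tending to minus infinity, where c > 0 is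
    essential. *)
Lemma cvg_lower_term :
  (lower_term mu tau (fx t) (fc t) (fw t) @[t --> F] -->
   lower_term mu tau x c w)%classic.
Proof.
rewrite {2}/lower_term; case: (ltgtP 0 w) => [w0|w0|w0].
- apply: cvg_trans (cvg_Phi_ratio (mu := mu) (tau := tau) cvgx cvgc cvgw _);
    last by rewrite gt_eqF.
  apply: near_eq_cvg; near=> t; rewrite /lower_term ifT//.
  by near: t; apply: (cvgr_gt _ cvgw).
- apply: cvg_near_cst.
  near=> t; rewrite /lower_term; apply/eqP; rewrite ifF//; apply/negbTE.
  rewrite -leNgt ltW//.
  by near: t; apply: (cvgr_lt _ cvgw).
- apply/cvgrPdist_lt => e /Phi_cvgNy[K Ke]; near=> t.
  rewrite sub0r normrN /lower_term; case: ifPn => [wt|_]; last first.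
    by rewrite normr0 (le_lt_trans _ Ke)// Phi_ge0.
  rewrite ger0_norm ?Phi_ge0//; apply: lt_trans Ke; apply: Phi_strict_mono.
  by move: wt; near: t; apply: (@ratio_lt R T F FF mu tau fx fc fw x c w).
Unshelve. all: by end_near. Qed.

Lemma cvg_upper_term :
  (upper_term mu tau (fx t) (fc t) (fw t) @[t --> F] -->
   upper_term mu tau x c w)%classic.
Proof.
rewrite {2}/upper_term; case: (ltgtP w 0) => [w0|w0|w0].
- apply: cvg_trans (cvg_Phi_ratio (mu := mu) (tau := tau) cvgx cvgc cvgw _);
    last by rewrite lt_eqF.
  apply: near_eq_cvg; near=> t; rewrite /upper_term ifT//.
  by near: t; apply: (cvgr_lt _ cvgw).
- apply: cvg_near_cst.
  near=> t; rewrite /upper_term; apply/eqP; rewrite ifF//; apply/negbTE.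
  rewrite -leNgt ltW//.
  by near: t; apply: (cvgr_gt _ cvgw).
- apply/cvgrPdist_lt => e e0.
  have [|K Ke] := @Phi_cvgy R (1 - e); first by rewrite gtrBl.
  near=> t.
  rewrite /upper_term; case: ifPn => [wt|_]; last by rewrite subrr normr0.
  rewrite ger0_norm ?subr_ge0 ?Phi_le1// ltrBlDr addrC -ltrBlDr.
  apply: (lt_trans Ke); apply: Phi_strict_mono.
  (* Changing the signs of [fx], [fw] and [mu] negates the whole argument, so the upper bound of
     [ratio_lt] becomes the lower bound K. *)
  have : 0 < - fw t -> (- fx t - fc t / - fw t - (- mu)) * tau < - K.
    near: t; apply: (@ratio_lt R T F FF (- mu) tau _ fc _ (- x) c (- w)) => //.
    - exact: (@cvgN _ R^o).
    - exact: (@cvgN _ R^o).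
    - by rewrite w0 oppr0.
  rewrite oppr_gt0 => /(_ wt).
  by rewrite invrN mulrN -!opprD mulNr ltrN2.
Unshelve. all: by end_near. Qed.

End TruncationTermsCvg.

(** * Limits of iterated operations *)

Section CvgBigMax.
Context {R : realType} {T : Type} {F : set_system T} {FF : Filter F}.
Implicit Types (f g : T -> R).

Lemma cvg_maxr f g (a b : R) :
  (f t @[t --> F] --> a)%classic -> (g t @[t --> F] --> b)%classic ->
  (Num.max (f t) (g t) @[t --> F] --> Num.max a b)%classic.
Proof.
move=> fa gb; rewrite maxr_absE.
under eq_fun do rewrite maxr_absE.
apply: cvgM; last exact: cvg_cst.
apply: (@cvgD _ R^o); first exact: (@cvgD _ R^o).
by apply: (@cvg_norm _ R^o); exact: (@cvgB _ R^o).
Qed.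

Lemma cvg_minr f g (a b : R) :
  (f t @[t --> F] --> a)%classic -> (g t @[t --> F] --> b)%classic ->
  (Num.min (f t) (g t) @[t --> F] --> Num.min a b)%classic.
Proof.
move=> fa gb; rewrite minr_absE.
under eq_fun do rewrite minr_absE.
apply: cvgM; last exact: cvg_cst.
apply: (@cvgB _ R^o); first exact: (@cvgD _ R^o).
by apply: (@cvg_norm _ R^o); exact: (@cvgB _ R^o).
Qed.

(** The operation is a parameter so that one induction serves the maxima and minima of truncation
    terms as well as the sums and products in matrix products and determinants. *)
Lemma cvg_big (op : R -> R -> R) (x0 : R) (I : Type) (s : seq I)
    (f : I -> T -> R) (a : I -> R) :
  (forall f g (a b : R), (f t @[t --> F] --> a)%classic ->
    (g t @[t --> F] --> b)%classic ->
    (op (f t) (g t) @[t --> F] --> op a b)%classic) ->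
  (forall i, (f i t @[t --> F] --> a i)%classic) ->
  (\big[op/x0]_(i <- s) f i t @[t --> F] --> \big[op/x0]_(i <- s) a i)%classic.
Proof.
move=> opc fa; elim: s => [|i s IHs].
  by rewrite big_nil; under eq_fun do rewrite big_nil; exact: cvg_cst.
by rewrite big_cons; under eq_fun do rewrite big_cons; exact: opc.
Qed.

End CvgBigMax.

(** * The CDF at the truncation endpoints *)

Section PhiBig.
Context {R : realType}.
Variables (mu tau x : R).
Hypothesis tau0 : 0 < tau.

Let h (t : \bar R) := Phi ((x%:E - t - mu%:E) * tau%:E)%E.

Let h_anti s t : (s <= t)%E -> h t <= h s.
Proof.
move=> st; apply: Phi_mono; apply: lee_wpmul2r; first by rewrite lee_fin ltW.
by apply: leeB => //; apply: leeB.
Qed.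

(** The map [h] is nonincreasing, so it turns minima into maxima, and it sends the empty minimum to
    [Phi] at minus infinity, the neutral element 0. *)
Lemma Phi_bigmin (I : Type) (s : seq I) (c w : I -> R) :
  Phi ((x%:E - \big[Order.min/+oo]_(i <- s | (0 < w i)%R) (c i / w i)%:E
    - mu%:E) * tau%:E)%E =
  \big[Num.max/0]_(i <- s) lower_term mu tau x (c i) (w i).
Proof.
transitivity (h (\big[Order.min/+oo]_(i <- s | (0 < w i)%R) (c i / w i)%:E)%E).
  by [].
rewrite (big_morph h (op1 := Num.max) (id1 := 0)); last 2 first.
- move=> u v; have [uv|/ltW vu] := leP u v.
    by rewrite max_l// h_anti.
  by rewrite max_r// h_anti.
- by rewrite /h /= gt0_mulNye ?lte_fin// PhiNy.
rewrite bigmax_mkcond; apply: eq_bigr => i _; rewrite /lower_term.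
by case: ifP.
Qed.

Lemma Phi_bigmax (I : Type) (s : seq I) (c w : I -> R) :
  Phi ((x%:E - \big[Order.max/-oo]_(i <- s | (w i < 0)%R) (c i / w i)%:E
    - mu%:E) * tau%:E)%E =
  \big[Num.min/1]_(i <- s) upper_term mu tau x (c i) (w i).
Proof.
transitivity (h (\big[Order.max/-oo]_(i <- s | (w i < 0)%R) (c i / w i)%:E)%E).
  by [].
rewrite (big_morph h (op1 := Num.min) (id1 := 1)); last 2 first.
- move=> u v; have [uv|/ltW vu] := leP u v.
    by rewrite min_r// h_anti.
  by rewrite min_l// h_anti.
- by rewrite /h /= gt0_mulye ?lte_fin// Phiy.
rewrite bigmin_mkcond; apply: eq_bigr => i _; rewrite /upper_term.
by case: ifP.
Qed.

End PhiBig.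

(** * The TG statistic for a unit direction *)

Section TruncatedPivot.
Context {R : realType}.

(* [p.1] is an entry of [Q y] and [p.2] the corresponding entry of [Q v]. *)
Definition pivot (mu tau x : R) (s : seq (R * R)) : R :=
  let A := \big[Num.max/0]_(p <- s) lower_term mu tau x p.1 p.2 in
  let B := \big[Num.min/1]_(p <- s) upper_term mu tau x p.1 p.2 in
  (B - Phi ((x - mu) * tau)%:E) / (B - A).

(** With [norm2 v = 1] the normalization of w disappears and the scale is [sigma^-1]. Listing pairs
    row by row removes the number of rows from the types. *)
Lemma TG_pivot n d k sigma (X : 'M[R]_(n, d)) (y : 'cV[R]_n) (M : model d k)
    (v : 'cV[R]_n) mu : 0 < sigma -> norm2 v = 1 ->
  TG sigma X y M v mu = pivot mu sigma^-1 (dot v y)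
    [seq ((r *m y) 0 0, (r *m v) 0 0) | r <- model_rows (design_data X) M].
Proof.
move=> sigma0 v1; rewrite /TG v1 mulr1 expr1n invr1 scale1r.
rewrite Phi_bigmin ?invr_gt0// Phi_bigmax ?invr_gt0//.
have rowQ (u : 'cV[R]_n) i :
    (Qmx M X *m u) i 0 = ((model_rows (design_data X) M)`_i *m u) 0 0.
  rewrite !mxE; apply: eq_bigr => l _; by rewrite !mxE.
rewrite /pivot !big_map; do 2 (rewrite (big_nth 0) big_mkord).
congr ((_ - _) / (_ - _)); apply: eq_bigr => i _ /=; congr (_ _ _ _ _).
all: exact: rowQ.
Qed.

End TruncatedPivot.

(** * Entrywise limits of matrices and of lists of rows *)

Section EntrywiseConvergence.
Context {R : realType} {T : Type} (F : set_system T) {FF : Filter F}.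

(** Stated by entries, so that products, determinants and inverses reduce to limits of real
    numbers. *)
Definition mcvg (m n : nat) (f : T -> 'M[R]_(m, n)) (A : 'M[R]_(m, n)) :=
  forall i j, (f t i j @[t --> F] --> A i j)%classic.

Lemma mcvg_cst m n (A : 'M[R]_(m, n)) : mcvg (fun=> A) A.
Proof. by move=> i j; exact: cvg_cst. Qed.

Lemma mcvgB m n (f g : T -> 'M[R]_(m, n)) A B :
  mcvg f A -> mcvg g B -> mcvg (fun t => f t - g t) (A - B).
Proof.
move=> fA gB i j; rewrite !mxE; under eq_fun do rewrite !mxE.
exact: (@cvgB _ R^o).
Qed.

Lemma mcvgZ m n (a : T -> R) (f : T -> 'M[R]_(m, n)) (b : R) A :
  (a t @[t --> F] --> b)%classic -> mcvg f A ->
  mcvg (fun t => a t *: f t) (b *: A).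
Proof.
move=> ab fA i j; rewrite mxE; under eq_fun do rewrite mxE.
exact: cvgM.
Qed.

Lemma mcvgZl m n (a : R) (f : T -> 'M[R]_(m, n)) A :
  mcvg f A -> mcvg (fun t => a *: f t) (a *: A).
Proof. by apply: mcvgZ; exact: cvg_cst. Qed.

Lemma mcvg_tr m n (f : T -> 'M[R]_(m, n)) A :
  mcvg f A -> mcvg (fun t => (f t)^T) A^T.
Proof.
by move=> fA i j; rewrite mxE; under eq_fun do rewrite mxE; exact: fA.
Qed.

Lemma mcvg_sub m n p q (g : 'I_p -> 'I_m) (h : 'I_q -> 'I_n)
    (f : T -> 'M[R]_(m, n)) A :
  mcvg f A -> mcvg (fun t => mxsub g h (f t)) (mxsub g h A).
Proof.
by move=> fA i j; rewrite mxE; under eq_fun do rewrite mxE; exact: fA.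
Qed.

Lemma mcvgM m n p (f : T -> 'M[R]_(m, n)) (g : T -> 'M[R]_(n, p)) A B :
  mcvg f A -> mcvg g B -> mcvg (fun t => f t *m g t) (A *m B).
Proof.
move=> fA gB i j; rewrite mxE; under eq_fun do rewrite mxE.
apply: cvg_big => [? ? ? ? ? ?|l]; first exact: (@cvgD _ R^o).
exact: cvgM.
Qed.

Lemma cvg_det n (f : T -> 'M[R]_n) A :
  mcvg f A -> (\det (f t) @[t --> F] --> \det A)%classic.
Proof.
move=> fA; rewrite /determinant.
apply: cvg_big => [? ? ? ? ? ?|s]; first exact: (@cvgD _ R^o).
apply: cvgM; first exact: cvg_cst.
by apply: cvg_big => [? ? ? ?|i]; [exact: cvgM|exact: fA].
Qed.

(** By Cramer's rule the inverse is the adjugate over the determinant, and both are polynomial in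
    the entries. *)
Lemma mcvgV n (f : T -> 'M[R]_n) A :
  A \in unitmx -> mcvg f A -> mcvg (fun t => invmx (f t)) (invmx A).
Proof.
move=> uA fA; have := uA; rewrite unitmxE unitfE => dA.
have : mcvg (fun t => (\det (f t))^-1 *: \adj (f t)) (invmx A).
  rewrite /invmx uA; apply: mcvgZ.
    by apply: cvgV => //; exact: cvg_det.
  move=> i j; rewrite mxE; under eq_fun do rewrite mxE.
  apply: cvgM; first exact: cvg_cst.
  apply: cvg_det; rewrite /row' /col' => k l; rewrite !mxE.
  by under eq_fun do rewrite !mxE; exact: fA.
move=> + i j => /(_ i j); apply: cvg_trans; apply: near_eq_cvg.
(* [invmx] returns a singular matrix unchanged; the formula is valid once the determinant is
   nonzero, which holds eventually. *)
near=> t; rewrite /invmx unitmxE unitfE ifT//.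
by near: t; apply: (cvgr_neq0 (\det A)) => //; exact: cvg_det.
Unshelve. all: by end_near. Qed.

(** A constant length lets rows be matched by position; beyond the end both sides read the zero row,
    so i is unrestricted. *)
Definition rows_cvg (m : nat) (f : T -> seq 'rV[R]_m) (s : seq 'rV[R]_m) :=
  (forall t, size (f t) = size s) /\ forall i, mcvg (fun t => (f t)`_i) s`_i.

Lemma rows_cvg_nil m : rows_cvg (fun=> [::] : seq 'rV[R]_m) [::].
Proof. by split=> // i; exact: mcvg_cst. Qed.

Lemma rows_cvg_cat m (f g : T -> seq 'rV[R]_m) r s :
  rows_cvg f r -> rows_cvg g s -> rows_cvg (fun t => f t ++ g t) (r ++ s).
Proof.
move=> [sf fr] [sg gs]; split=> [t|i]; first by rewrite !size_cat sf sg.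
rewrite nth_cat; under eq_fun do rewrite nth_cat sf.
by case: ifP => _; [exact: fr|exact: gs].
Qed.

(** Convergence is asked of members only, since denominators are known to be nonzero only for actual
    candidates. *)
Lemma rows_cvg_map m (I : eqType) (s : seq I) (f : I -> T -> 'rV[R]_m) g :
  {in s, forall i, mcvg (f i) (g i)} ->
  rows_cvg (fun t => [seq f i t | i <- s]) [seq g i | i <- s].
Proof.
elim: s => [|i s IHs] fg; first exact: rows_cvg_nil.
have [sz h] : rows_cvg (fun t => [seq f i t | i <- s]) [seq g i | i <- s].
  by apply: IHs => j js; apply: fg; rewrite inE js orbT.
split=> [t|[|j]] /=; [by rewrite sz|by apply: fg; rewrite mem_head|exact: h].
Qed.

Lemma rows_cvg_allpairs m (I J : eqType) (s : seq I) (r : seq J)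
    (f : I -> J -> T -> 'rV[R]_m) g :
  {in s, forall i j, mcvg (f i j) (g i j)} ->
  rows_cvg (fun t => [seq f i j t | i <- s, j <- r])
    [seq g i j | i <- s, j <- r].
Proof.
elim: s => [|i s IHs] fg; first exact: rows_cvg_nil.
apply: rows_cvg_cat.
  by apply: rows_cvg_map => j _; apply: fg; rewrite mem_head.
by apply: IHs => j js; apply: fg; rewrite inE js orbT.
Qed.

End EntrywiseConvergence.

(** * Continuity of the rows of P_M(S) in S *)

Section ModelRowsConvergence.
Context {R : realType} {d : nat} {T : Type} (F : set_system T) {FF : Filter F}.
Variables (S : T -> 'M[R]_d) (S0 : 'M[R]_d).
Hypothesis cvgS : mcvg F S S0.

Local Notation D t := (gram_data (S t)).
Local Notation D0 := (gram_data S0).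
Local Notation "f ~> A" := (mcvg F f A) (at level 70).
Implicit Types (A : seq 'I_d) (a : seq ('I_d * bool)) (e : event d).

Lemma mcvg_subcross j A : (fun t => subcross (S t) j A) ~> subcross S0 j A.
Proof.
by move=> i l; rewrite mxE; under eq_fun do rewrite mxE; exact: cvgS.
Qed.

Lemma mcvg_invgram A : subgram S0 A A \in unitmx ->
  (fun t => invmx (subgram (S t) A A)) ~> invmx (subgram S0 A A).
Proof. by move=> uA; apply: mcvgV => //; exact: mcvg_sub. Qed.

Section FixedActiveSet.
Variable A : seq 'I_d.
Hypothesis uA : subgram S0 A A \in unitmx.

Lemma mcvg_coef j : (fun t => sd_coef (D t) A j) ~> sd_coef D0 A j.
Proof.
apply: mcvgM; last exact: mcvg_cst.
by apply: mcvgM; [exact: mcvg_cst|exact: mcvg_invgram].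
Qed.

Lemma mcvg_cross_inv j :
  (fun t => subcross (S t) j A *m invmx (subgram (S t) A A)) ~>
  subcross S0 j A *m invmx (subgram S0 A A).
Proof. by apply: mcvgM; [exact: mcvg_subcross|exact: mcvg_invgram]. Qed.

Lemma mcvg_resid j : (fun t => sd_resid (D t) A j) ~> sd_resid D0 A j.
Proof.
apply: mcvgB; first exact: mcvg_cst.
by apply: mcvgM; [exact: mcvg_cross_inv|exact: mcvg_cst].
Qed.

Lemma cvg_rss j : (sd_rss (D t) A j @[t --> F] --> sd_rss D0 A j)%classic.
Proof.
apply: (@cvgB _ R^o); first exact: cvgS.
apply: mcvgM; first exact: mcvg_cross_inv.
by apply: mcvg_tr; exact: mcvg_subcross.
Qed.

Lemma mcvg_score j : sd_rss D0 A j != 0 ->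
  (fun t => fs_score (D t) A j) ~> fs_score D0 A j.
Proof.
move=> rss0; apply: mcvgZ; last exact: mcvg_resid.
by apply: cvgV => //; exact: cvg_rss.
Qed.

Lemma rows_cvg_sign s :
  rows_cvg F (fun t => sign_rows (D t) A s) (sign_rows D0 A s).
Proof. by apply: rows_cvg_map => p _; apply: mcvgZl; exact: mcvg_coef. Qed.

End FixedActiveSet.

Lemma mcvg_knot a e : subgram S0 (unzip1 a) (unzip1 a) \in unitmx ->
  knot_den D0 a e != 0 -> (fun t => knot (D t) a e) ~> knot D0 a e.
Proof.
move=> ua den0; apply: mcvgZ.
  apply: cvgV => //; rewrite /knot_den; case: e {den0} => [[j s]|j] /=.
    apply: (@cvgB _ R^o); first exact: cvg_cst.
    by apply: mcvgM; [exact: mcvg_cross_inv|exact: mcvg_cst].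
  apply: mcvgM; last exact: mcvg_cst.
  by apply: mcvgM; [exact: mcvg_cst|exact: mcvg_invgram].
by case: e {den0} => [[j s]|j]; [exact: mcvg_resid|exact: mcvg_coef].
Qed.

Lemma rows_cvg_fs A st : subgram S0 A A \in unitmx ->
  fs_possible A st -> fs_defined D0 A st ->
  rows_cvg F (fun t => fs_rows (D t) A st) (fs_rows D0 A st).
Proof.
elim: st A => [|q st IHst] A uA /=; first by move=> _ _; exact: rows_cvg_nil.
move=> /and3P[qA _ pst] [rss0 uB dst].
apply: rows_cvg_cat; last exact: IHst.
apply: rows_cvg_cat; last exact: rows_cvg_sign.
(* The entering variable and its competitors all lie outside A, where [fs_defined] makes the
   residual norms nonzero. *)
apply: rows_cvg_allpairs => j + s; rewrite mem_filter mem_rcons inE negb_or.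
move=> /andP[/andP[_ jA] _].
by apply: mcvgB; apply: mcvgZl; apply: mcvg_score => //; exact: rss0.
Qed.

(** The previous knot was built from an earlier active list, so its convergence is carried along as
    an invariant of the induction on steps. *)
Lemma rows_cvg_path cross first (prev : T -> option 'rV[R]_d) prev0 a
    banned st :
  match prev0 with
  | Some l0 => exists2 l, forall t, prev t = Some (l t) & l ~> l0
  | None => forall t, prev t = None
  end ->
  subgram S0 (unzip1 a) (unzip1 a) \in unitmx ->
  path_possible cross first a banned st ->
  path_defined D0 cross a banned st ->
  rows_cvg F (fun t => path_rows (D t) cross (prev t) a banned st)
    (path_rows D0 cross prev0 a banned st).
Proof.
elim: st first prev prev0 a banned => [|q st IHst] first prev prev0 a banned
  hprev ua /=; first by move=> _ _; exact: rows_cvg_nil.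
move=> /and5P[/forallP eligc _ qelig _ pst] [den0 ub dst].
have knotc e : e \in cands cross a banned ->
    (fun t => knot (D t) a e) ~> knot D0 a e.
  by move=> ec; apply: mcvg_knot => //; exact: den0.
(* The occurring event is eligible, hence a candidate with nonzero denominator. *)
have knotq : (fun t => knot (D t) a (ps_event q)) ~> knot D0 a (ps_event q).
  by apply: knotc; exact: (implyP (eligc _)).
apply: rows_cvg_cat; last first.
  apply: rows_cvg_cat; first exact: rows_cvg_sign.
  by apply: IHst pst dst => //; exists (fun t => knot (D t) a (ps_event q)).
apply: rows_cvg_cat.
  case: prev0 hprev => [l0 [l prevl ll0]|prevN]; last first.
    by under eq_fun do rewrite prevN; exact: rows_cvg_nil.
  under eq_fun do rewrite prevl.
  apply: rows_cvg_map => e ec.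
  by case: ifP => _; apply: mcvgB => //; exact: knotc.
apply: rows_cvg_cat.
  apply: rows_cvg_map => e; rewrite mem_filter => /andP[_ ec].
  by apply: mcvgB => //; exact: knotc.
by split=> // -[|i] //=; exact: mcvg_cst.
Qed.

Lemma rows_cvg_model k (M : model d k) : possible M -> model_defined D0 M ->
  rows_cvg F (fun t => model_rows (D t) M) (model_rows D0 M).
Proof.
have u0 : subgram S0 [::] [::] \in unitmx by rewrite unitmxE det_mx00 unitr1.
case: M => st; first exact: rows_cvg_fs.
  exact: rows_cvg_path.
exact: rows_cvg_path.
Qed.

End ModelRowsConvergence.

(** * Continuity of the pivot where all inequalities are strict *)

Section PivotConvergence.
Context {R : realType} {d : nat} {T : Type} {F : set_system T} {FF : Filter F}.
Variables (mu tau : R) (x : T -> R) (x0 : R) (rs : T -> seq 'rV[R]_d)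
  (rs0 : seq 'rV[R]_d) (z u : T -> 'cV[R]_d) (z0 u0 : 'cV[R]_d).
Hypothesis tau0 : 0 < tau.
Hypothesis cvgx : (x t @[t --> F] --> x0)%classic.
Hypothesis cvgrs : rows_cvg F rs rs0.
Hypothesis cvgz : mcvg F z z0.
Hypothesis cvgu : mcvg F u u0.
Hypothesis pos : forall i : 'I_(size rs0), 0 < (rs0`_i *m z0) 0 0.

Let pairs (r : seq 'rV[R]_d) (z u : 'cV[R]_d) :=
  [seq ((v *m z) 0 0, (v *m u) 0 0) | v <- r].

Lemma cvg_pivot :
  (pivot mu tau (x t) (pairs (rs t) (z t) (u t)) @[t --> F] -->
   pivot mu tau x0 (pairs rs0 z0 u0))%classic.
Proof.
have [szE rsc] := cvgrs.
pose lo t i := lower_term mu tau (x t) (((rs t)`_i *m z t) 0 0)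
  (((rs t)`_i *m u t) 0 0).
pose hi t i := upper_term mu tau (x t) (((rs t)`_i *m z t) 0 0)
  (((rs t)`_i *m u t) 0 0).
pose lo0 i := lower_term mu tau x0 ((rs0`_i *m z0) 0 0) ((rs0`_i *m u0) 0 0).
pose hi0 i := upper_term mu tau x0 ((rs0`_i *m z0) 0 0) ((rs0`_i *m u0) 0 0).
have pE t : pivot mu tau (x t) (pairs (rs t) (z t) (u t)) =
    (\big[Num.min/1]_(i < size rs0) hi t i - Phi ((x t - mu) * tau)%:E) /
    (\big[Num.min/1]_(i < size rs0) hi t i
      - \big[Num.max/0]_(i < size rs0) lo t i).
  by rewrite /pivot !big_map; do 2 (rewrite (big_nth 0) big_mkord szE).
have p0E : pivot mu tau x0 (pairs rs0 z0 u0) =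
    (\big[Num.min/1]_(i < size rs0) hi0 i - Phi ((x0 - mu) * tau)%:E) /
    (\big[Num.min/1]_(i < size rs0) hi0 i
      - \big[Num.max/0]_(i < size rs0) lo0 i).
  by rewrite /pivot !big_map; do 2 (rewrite (big_nth 0) big_mkord).
under eq_fun do rewrite pE.
rewrite p0E.
have cP : (Phi ((x t - mu) * tau)%:E @[t --> F] -->
    Phi ((x0 - mu) * tau)%:E)%classic.
  apply: (cvg_comp (fun t => (x t - mu) * tau)
    (fun u => Phi u%:E)); last exact: continuous_Phi.
  by apply: cvgM; [apply: (@cvgB _ R^o) => //|]; exact: cvg_cst.
have chi : (\big[Num.min/1]_(i < size rs0) hi t i @[t --> F] -->
    \big[Num.min/1]_(i < size rs0) hi0 i)%classic.
  apply: cvg_big => [*|i]; first exact: cvg_minr.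
  by apply: cvg_upper_term => //; exact: mcvgM.
have clo : (\big[Num.max/0]_(i < size rs0) lo t i @[t --> F] -->
    \big[Num.max/0]_(i < size rs0) lo0 i)%classic.
  apply: cvg_big => [*|i]; first exact: cvg_maxr.
  by apply: cvg_lower_term => //; exact: mcvgM.
apply: cvgM; first exact: (@cvgB _ R^o).
apply: cvgV; last exact: (@cvgB _ R^o).
(* The limit denominator is positive because [Phi] at the observed value strictly separates the
   lower terms from the upper ones: each ratio has a positive numerator, and the default values 0
   and 1 are never attained. *)
rewrite subr_eq0 gt_eqF//; apply: (@lt_trans _ _ (Phi ((x0 - mu) * tau)%:E)).
  apply: bigmax_lt => [|i _]; first exact: Phi_gt0.
  rewrite /lo0 /lower_term; case: ifPn => [w0|_]; last exact: Phi_gt0.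
  apply: Phi_strict_mono; rewrite ltr_pM2r// ltrD2r gtrBl.
  by rewrite divr_gt0.
apply: lt_bigmin => [|i _]; first exact: Phi_lt1.
rewrite /hi0 /upper_term; case: ifPn => [w0|_]; last exact: Phi_lt1.
apply: Phi_strict_mono; rewrite ltr_pM2r// ltrD2r -subr_gt0 addrC addrA.
by rewrite addNr add0r -mulrN -invrN divr_gt0// oppr_gt0.
Qed.

End PivotConvergence.

(** * Positive semidefinite matrices *)

Section PositiveSemidefinite.
Context {R : realType}.

Lemma dotE n (u v : 'cV[R]_n) : dot u v = \sum_i u i 0 * v i 0.
Proof. by rewrite /dot mxE; apply: eq_bigr => i _; rewrite mxE. Qed.

Lemma dot_ge0 n (u : 'cV[R]_n) : 0 <= dot u u.
Proof. by rewrite dotE sumr_ge0// => i _; rewrite -expr2 sqr_ge0. Qed.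

Lemma dot_eq0 n (u : 'cV[R]_n) : dot u u = 0 -> u = 0.
Proof.
rewrite dotE => /eqP; rewrite psumr_eq0 => [/allP u0|i _]; last first.
  by rewrite -expr2 sqr_ge0.
apply/colP => i; rewrite mxE; apply/eqP.
by have := u0 i (mem_index_enum i); rewrite /= mulf_eq0 orbb.
Qed.

Lemma dotZZ n (a b : R) (u v : 'cV[R]_n) :
  dot (a *: u) (b *: v) = a * b * dot u v.
Proof.
by rewrite !dotE mulr_sumr; apply: eq_bigr => i _; rewrite !mxE mulrACA.
Qed.

Definition psd n (G : 'M[R]_n) :=
  G^T = G /\ forall u : 'cV[R]_n, 0 <= dot u (G *m u).

(** If w = G u were nonzero, moving from u a little along -w would make the quadratic form
    negative. *)
Lemma psd_dot_eq0 n (G : 'M[R]_n) (u : 'cV[R]_n) :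
  psd G -> dot u (G *m u) = 0 -> G *m u = 0.
Proof.
move=> [symG psdG] u0; apply: dot_eq0; apply/eqP; set w := G *m u.
rewrite eq_le dot_ge0 andbT leNgt; apply/negP => q0.
set q := dot w w in q0 *; set r := dot w (G *m w).
have r0 : 0 <= r by exact: psdG.
(* This gives [t * r <= q < 2 * q], so the form [t * (t * r - 2 * q)] is negative; the 1 covers r =
   0. *)
pose t := q / (r + 1).
have uGw : dot u (G *m w) = q.
  by rewrite /q {2}/w /dot trmx_mul symG mulmxA.
have := psdG (u - t *: w).
have -> : dot (u - t *: w) (G *m (u - t *: w)) = t * (t * r - 2 * q).
  rewrite mulmxBr -scalemxAr -/w.
  have -> : dot (u - t *: w) (w - t *: (G *m w)) =
      dot u w - t * dot u (G *m w) - t * dot w w + t ^+ 2 * dot w (G *m w).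
    rewrite !dotE !mulr_sumr -!sumrB -big_split/=; apply: eq_bigr => i _.
    rewrite !mxE; ring.
  by rewrite u0 uGw -/q -/r; ring.
have t0 : 0 < t by rewrite divr_gt0// ltr_wpDl.
rewrite pmulr_rge0// leNgt => /negP; apply.
rewrite subr_lt0; apply: (@le_lt_trans _ _ q); last by rewrite ltr_pMl// ltr1n.
by rewrite /t mulrAC ler_pdivrMr ?ltr_wpDl// ler_pM2l// lerDl.
Qed.

(** With u the solution of G u = e, the value is the form of G at u; if it vanished, e = G u would
    be 0. *)
Lemma psd_inv_gt0 n (G : 'M[R]_n) (e : 'cV[R]_n) :
  psd G -> G \in unitmx -> e != 0 -> 0 < (e^T *m invmx G *m e) 0 0.
Proof.
move=> psdG uG e0; have [symG posG] := psdG.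
pose u := invmx G *m e.
have Gu : G *m u = e by rewrite /u mulmxA mulmxV// mul1mx.
have -> : (e^T *m invmx G *m e) 0 0 = dot u (G *m u).
  by rewrite Gu /dot /u trmx_mul trmx_inv symG.
rewrite lt_def posG andbT; apply: contra_neq e0 => u0.
by rewrite -Gu; exact: psd_dot_eq0.
Qed.

End PositiveSemidefinite.

(** * Principal submatrices *)

Section Subgram.
Context {R : realType} {d : nat}.
Implicit Types (A : seq 'I_d).

Lemma mul_restrl m A (B : 'M[R]_(d, m)) :
  restr A *m B = rowsub (tnth (in_tuple A)) B.
Proof. by rewrite /restr mul_rowsub_mx mul1mx. Qed.

Lemma subgramE (S : 'M[R]_d) A : subgram S A A = restr A *m S *m (restr A)^T.
Proof.
rewrite mul_restrl -[RHS]trmxK trmx_mul trmxK mul_restrl.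
by apply/matrixP => i j; rewrite !mxE.
Qed.

Lemma restrK A : uniq A -> restr A *m (restr A)^T = 1%:M :> 'M[R]_(size A).
Proof.
move=> uA; rewrite mul_restrl; apply/matrixP => i j; rewrite !mxE eq_sym.
have /tuple_uniqP/inj_eq -> : uniq (in_tuple A) by [].
by [].
Qed.

Lemma psd_subgram (S : 'M[R]_d) A : psd S -> psd (subgram S A A).
Proof.
move=> [symS posS]; split=> [|u].
  by apply/matrixP => i j; rewrite !mxE -[in LHS]symS mxE.
have := posS ((restr A)^T *m u).
by rewrite subgramE /dot trmx_mul trmxK !mulmxA.
Qed.

(** A kernel vector of the submatrix, padded with zeros, annihilates the form of S. It then lies in
    the kernel of S, so it is 0, and restricting back to A gives v = 0. *)
Lemma subgram_unit (S : 'M[R]_d) A : uniq A -> psd S -> S \in unitmx ->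
  subgram S A A \in unitmx.
Proof.
move=> uA psdS uS; have psdG := psd_subgram A psdS.
rewrite unitmxE unitfE; apply/negP => /det0P[v v0 vG]; case/eqP: v0.
pose w := (restr A)^T *m v^T.
have w0 : dot w (S *m w) = 0.
  have : v *m subgram S A A *m v^T = 0 by rewrite vG mul0mx.
  rewrite subgramE => /matrixP/(_ 0 0); rewrite [RHS]mxE => <-.
  by rewrite /dot /w trmx_mul !trmxK !mulmxA.
have {}w0 : w = 0.
  by rewrite -[w](mulKmx uS) (psd_dot_eq0 psdS w0) mulmx0.
by rewrite -[v]trmxK -[v^T]mul1mx -(restrK uA) -mulmxA -/w w0 mulmx0 trmx0.
Qed.

Lemma bvec_neq0 A j : j \in A -> bvec A j != 0 :> 'cV[R]_(size A).
Proof.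
move=> jA; apply/eqP => /colP.
have i0 : (index j A < size A)%N by rewrite index_mem.
move=> /(_ (Ordinal i0)); rewrite !mxE (tnth_nth j) /= nth_index// eqxx.
by move/eqP; rewrite oner_eq0.
Qed.

End Subgram.

(** * The function psi_M and its continuity *)

Section GramDirection.
Context {R : realType} {d : nat}.
Variables (A : seq 'I_d) (j : 'I_d).
Implicit Types S : 'M[R]_d.

(* [e_j^T (X_A^T X_A)^-1 e_j] *)
Definition inv_diag S : R :=
  ((bvec A j)^T *m invmx (subgram S A A) *m bvec A j) 0 0.

(* [v^T y] as a function of [(S, z)] *)
Definition gram_proj S (z : 'cV[R]_d) : R :=
  (Num.sqrt (inv_diag S))^-1 * (sd_coef (gram_data S) A j *m z) 0 0.

(* [X^T v], up to the factor [sqrt n], as a function of [S] *)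
Definition gram_dir S : 'cV[R]_d :=
  (Num.sqrt (inv_diag S))^-1 *: (S *m (sd_coef (gram_data S) A j)^T).

(** This is psi_M, with [tau] standing for the reciprocal noise level. *)
Definition gram_pivot k (M : model d k) (mu tau : R) S (z : 'cV[R]_d) : R :=
  pivot mu tau (gram_proj S z)
    [seq ((r *m z) 0 0, (r *m gram_dir S) 0 0)
      | r <- model_rows (gram_data S) M].

Section Convergence.
Context {T : Type} {F : set_system T} {FF : Filter F}.
Variables (S : T -> 'M[R]_d) (S0 : 'M[R]_d) (z : T -> 'cV[R]_d) (z0 : 'cV[R]_d).
Hypothesis cvgS : mcvg F S S0.
Hypothesis cvgz : mcvg F z z0.
Hypothesis uniqA : uniq A.
Hypothesis jA : j \in A.
Hypothesis psdS : psd S0.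
Hypothesis uS : S0 \in unitmx.

Let uG := subgram_unit uniqA psdS uS.

Lemma cvg_sqrt_inv_diag :
  ((Num.sqrt (inv_diag (S t)))^-1 @[t --> F] -->
   (Num.sqrt (inv_diag S0))^-1)%classic.
Proof.
have pos : 0 < inv_diag S0.
  by apply: psd_inv_gt0 => //; [exact: psd_subgram|exact: bvec_neq0].
apply: cvgV; first by rewrite gt_eqF// sqrtr_gt0.
apply: (cvg_comp (fun t => inv_diag (S t)) Num.sqrt); last first.
  exact: sqrt_continuous.
apply: mcvgM; last exact: mcvg_cst.
by apply: mcvgM; [exact: mcvg_cst|exact: mcvg_invgram].
Qed.

(** Symmetry, semidefiniteness and invertibility concern the limit [S0]; the matrices [S t] range
    over everything near it. *)
Lemma cvg_gram_pivot k (M : model d k) mu tau : 0 < tau ->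
  possible M -> model_defined (gram_data S0) M ->
  (forall i, 0 < (Pmx M S0 *m z0) i 0) ->
  (gram_pivot M mu tau (S t) (z t) @[t --> F] -->
   gram_pivot M mu tau S0 z0)%classic.
Proof.
move=> tau0 pM dM pos; apply: cvg_pivot => //.
- apply: cvgM; first exact: cvg_sqrt_inv_diag.
  by apply: mcvgM => //; exact: mcvg_coef.
- exact: rows_cvg_model.
- apply: mcvgZ; first exact: cvg_sqrt_inv_diag.
  by apply: mcvgM => //; apply: mcvg_tr; exact: mcvg_coef.
- move=> i; have := pos i; rewrite !mxE; congr (_ < _).
  by apply: eq_bigr => l _; rewrite !mxE.
Qed.

End Convergence.
End GramDirection.

(** * Invariance under positive scaling of rows *)

Section PivotScaling.
Context {R : realType}.

(** A truncation term sees a pair only through the sign of its second entry and the ratio of the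
    two, so each row may have its own factor. *)
Lemma pivot_scale (mu tau x : R) (s1 s2 : seq (R * R)) :
  size s1 = size s2 ->
  (forall i, exists2 c, 0 < c & s1`_i = (c * (s2`_i).1, c * (s2`_i).2)) ->
  pivot mu tau x s1 = pivot mu tau x s2.
Proof.
move=> sz s12; rewrite /pivot; do 2 rewrite (big_nth 0) big_mkord.
do 2 rewrite [in RHS](big_nth 0) big_mkord.
have lowE (i : nat) : lower_term mu tau x (s1`_i).1 (s1`_i).2 =
    lower_term mu tau x (s2`_i).1 (s2`_i).2.
  have [c c0 ->] := s12 i; rewrite /lower_term /= pmulr_rgt0//.
  by rewrite -mulf_div divff ?gt_eqF// mul1r.
have upE (i : nat) : upper_term mu tau x (s1`_i).1 (s1`_i).2 =
    upper_term mu tau x (s2`_i).1 (s2`_i).2.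
  have [c c0 ->] := s12 i; rewrite /upper_term /= pmulr_rlt0//.
  by rewrite -mulf_div divff ?gt_eqF// mul1r.
rewrite sz.
by congr ((_ - _) / (_ - _)); apply: eq_bigr => i _.
Qed.

End PivotScaling.

(** * Comparing the rows of P_M and Q_M *)

Section DesignToGram.
Context {R : realType} {n d : nat}.
Hypothesis n0 : (0 < n)%N.
Variable X : 'M[R]_(n, d).

Local Notation S := (n%:R^-1 *: (X^T *m X)).
Local Notation rn := (Num.sqrt n%:R : R).
Local Notation DX := (design_data X).
Local Notation DS := (gram_data S).
Implicit Types (A : seq 'I_d) (a : seq ('I_d * bool)) (e : event d).

(* A functional of [z], read as a functional of [y] through
   [z = X^T y / sqrt n]. *)
Definition pull (r : 'rV[R]_d) : 'rV[R]_n := rn^-1 *: (r *m X^T).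

Let nR0 : (0 : R) < n%:R. Proof. by rewrite ltr0n. Qed.
Let nR_neq0 : n%:R != 0 :> R. Proof. by rewrite gt_eqF. Qed.
Let rn0 : 0 < rn. Proof. by rewrite sqrtr_gt0. Qed.
Let rn_neq0 : rn != 0. Proof. by rewrite gt_eqF. Qed.
Let rnV0 : 0 < rn^-1. Proof. by rewrite invr_gt0. Qed.
Let rnrn : rn * rn = n%:R. Proof. by rewrite -expr2 sqr_sqrtr// ltW. Qed.
Let rnVn : rn^-1 * n%:R = rn.
Proof. by apply: (mulfI rn_neq0); rewrite mulVKf// rnrn. Qed.

Lemma pull0 : pull 0 = 0. Proof. by rewrite /pull mul0mx scaler0. Qed.

Lemma pullZ c r : pull (c *: r) = c *: pull r.
Proof. by rewrite /pull -scalemxAl !scalerA mulrC. Qed.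

Lemma pullB r s : pull (r - s) = pull r - pull s.
Proof. by rewrite /pull mulmxBl scalerBr. Qed.

Lemma colsE A : cols X A = X *m (restr A)^T.
Proof.
rewrite -[RHS]trmxK trmx_mul trmxK mul_restrl.
by apply/matrixP => i l; rewrite !mxE.
Qed.

Lemma restr_pull A : restr A *m X^T = (cols X A)^T.
Proof. by rewrite colsE trmx_mul trmxK. Qed.

Lemma gramE A : gram X A = n%:R *: subgram S A A.
Proof.
rewrite subgramE -!(scalemxAl, scalemxAr) scalerA divff// scale1r.
by rewrite /gram colsE trmx_mul trmxK !mulmxA.
Qed.

Lemma subcrossE j A : subcross S j A = n%:R^-1 *: ((col j X)^T *m cols X A).
Proof.
apply/rowP => i; rewrite !mxE; congr (_ * _); apply: eq_bigr => l _.
by rewrite !mxE.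
Qed.

Section FixedActiveSet.
Variable A : seq 'I_d.
Hypothesis uA : gram X A \in unitmx.

Lemma invmx_subgram : invmx (subgram S A A) = n%:R *: invmx (gram X A).
Proof.
have SE : subgram S A A = n%:R^-1 *: gram X A.
  by rewrite gramE scalerA mulVf// scale1r.
rewrite SE invmxZ ?invrK//.
by rewrite unitmxZ// unitfE invr_eq0.
Qed.

Lemma gram_sym : (gram X A)^T = gram X A.
Proof. by rewrite /gram trmx_mul trmxK. Qed.

(** The inverse Gram matrix contributes n and [pull] contributes [rn^-1]. *)
Lemma pull_coef j : pull (sd_coef DS A j) = rn *: sd_coef DX A j.
Proof.
rewrite /pull /= invmx_subgram -scalemxAr -!scalemxAl scalerA rnVn.
congr (_ *: _); rewrite -mulmxA restr_pull /coef_vec !trmx_mul trmx_inv.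
by rewrite gram_sym !mulmxA.
Qed.

Lemma cross_inv j : subcross S j A *m invmx (subgram S A A) =
  (col j X)^T *m cols X A *m invmx (gram X A).
Proof.
rewrite subcrossE invmx_subgram -scalemxAl -scalemxAr scalerA mulVf//.
by rewrite scale1r.
Qed.

Lemma pull_resid j : pull (sd_resid DS A j) = rn^-1 *: sd_resid DX A j.
Proof.
rewrite /pull /= cross_inv mulmxBl -[_ *m restr A *m _]mulmxA restr_pull.
rewrite /proj_perp.
congr (_ *: _); rewrite mulmxBr mulmx1 !mulmxA -rowE; congr (_ - _).
by apply/rowP => i; rewrite !mxE.
Qed.

Lemma rssE j : sd_rss DS A j = n%:R^-1 * sd_rss DX A j.
Proof.
(* The projector is symmetric and idempotent, which turns the squared norm of P X_j into X_j^T P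
   X_j. *)
rewrite /= cross_inv subcrossE /norm2 sqr_sqrtr ?dot_ge0//.
have symP : (proj_perp X A)^T = proj_perp X A.
  rewrite /proj_perp linearB/= trmx1 !trmx_mul trmxK trmx_inv gram_sym.
  by rewrite mulmxA.
have idemP : proj_perp X A *m proj_perp X A = proj_perp X A.
  rewrite {1}/proj_perp mulmxBl mul1mx; apply/eqP.
  rewrite subr_eq addrC -subr_eq subrr eq_sym; apply/eqP.
  rewrite /proj_perp mulmxBr mulmx1 !mulmxA.
  rewrite -[_ *m (cols X A)^T *m cols X A]mulmxA -/(gram X A).
  by rewrite -[_ *m gram X A]mulmxA mulVmx// mulmx1 subrr.
have -> : dot (proj_perp X A *m col j X) (proj_perp X A *m col j X) =
    ((col j X)^T *m proj_perp X A *m col j X) 0 0.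
  rewrite /dot trmx_mul symP mulmxA.
  by rewrite -[_ *m proj_perp X A *m proj_perp X A]mulmxA idemP.
have mxB (B C : 'M[R]_1) : (B - C) 0 0 = B 0 0 - C 0 0 by rewrite !mxE.
rewrite /proj_perp mulmxBr mulmx1 mulmxBl mxB mulrBr.
congr (_ - _).
  rewrite mxE; congr (_ * _); rewrite !mxE.
  by apply: eq_bigr => l _; rewrite !mxE.
by rewrite linearZ/= -scalemxAr mxE trmx_mul trmxK !mulmxA mxE.
Qed.

Lemma pull_score j : pull (fs_score DS A j) = rn *: fs_score DX A j.
Proof.
rewrite /fs_score pullZ pull_resid rssE !scalerA invfM invrK.
by congr (_ *: _); rewrite mulrAC [_ * rn^-1]mulrC rnVn.
Qed.

End FixedActiveSet.

(** For joining, the residual gives [rn^-1] and the denominator is unchanged; for crossing, the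
    coefficient gives [rn] and the denominator n. The common factor is what lets differences of
    joining and crossing knots scale as rows. *)
Lemma pull_knot a e : gram X (unzip1 a) \in unitmx ->
  pull (knot DS a e) = rn^-1 *: knot DX a e.
Proof.
move=> ua; rewrite /knot pullZ; case: e => [[j s]|j].
  have -> : knot_den DS a (inl (j, s)) = knot_den DX a (inl (j, s)).
    by rewrite /= cross_inv.
  by rewrite (pull_resid ua) !scalerA mulrC.
have -> : knot_den DS a (inr j) = n%:R * knot_den DX a (inr j).
  by rewrite /= invmx_subgram// -scalemxAr -scalemxAl [LHS]mxE.
rewrite (pull_coef ua) !scalerA invfM; congr (_ *: _).
rewrite mulrAC; congr (_ * _); apply: (mulfI nR_neq0).
by rewrite mulVKf// mulrC rnVn.
Qed.

(** The factor depends on the row: sign rows scale by [rn], knot rows by [rn^-1]. *)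
Definition pos_scaled (rs : seq 'rV[R]_d) (rx : seq 'rV[R]_n) :=
  size rs = size rx /\
  forall i, exists2 c, 0 < c & pull rs`_i = c *: rx`_i.

Lemma pos_scaled_nil : pos_scaled [::] [::].
Proof. by split=> // i; exists 1; rewrite ?nth_nil ?pull0 ?scaler0. Qed.

Lemma pos_scaled_cat r1 r2 s1 s2 :
  pos_scaled r1 s1 -> pos_scaled r2 s2 -> pos_scaled (r1 ++ r2) (s1 ++ s2).
Proof.
move=> [z1 h1] [z2 h2]; split=> [|i]; first by rewrite !size_cat z1 z2.
by rewrite !nth_cat z1; case: ifP.
Qed.

Lemma pos_scaled_cons r1 r2 s1 s2 c : 0 < c -> pull r1 = c *: s1 ->
  pos_scaled r2 s2 -> pos_scaled (r1 :: r2) (s1 :: s2).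
Proof.
move=> c0 rs [z h]; split=> [|[|i]] /=; [by rewrite z|by exists c|exact: h].
Qed.

Lemma pos_scaled_map (I : Type) (s : seq I) f g c : 0 < c ->
  (forall i, pull (f i) = c *: g i) ->
  pos_scaled [seq f i | i <- s] [seq g i | i <- s].
Proof.
move=> c0 fg; elim: s => [|i s IHs]; first exact: pos_scaled_nil.
exact: pos_scaled_cons (fg i) IHs.
Qed.

Lemma pos_scaled_allpairs (I J : Type) (s : seq I) (t : seq J) f g c : 0 < c ->
  (forall i j, pull (f i j) = c *: g i j) ->
  pos_scaled [seq f i j | i <- s, j <- t] [seq g i j | i <- s, j <- t].
Proof.
move=> c0 fg; elim: s => [|i s IHs]; first exact: pos_scaled_nil.
by apply: pos_scaled_cat => //=; apply: pos_scaled_map c0 _.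
Qed.

Lemma pos_scaled_sign A s : gram X A \in unitmx ->
  pos_scaled (sign_rows DS A s) (sign_rows DX A s).
Proof.
move=> uA; apply: (pos_scaled_map _ rn0) => p.
by rewrite pullZ pull_coef// !scalerA mulrC.
Qed.

Lemma pos_scaled_fs A st : gram X A \in unitmx -> fs_defined DX A st ->
  pos_scaled (fs_rows DS A st) (fs_rows DX A st).
Proof.
elim: st A => [|q st IHst] A uA /=; first by move=> _; exact: pos_scaled_nil.
move=> [_ uB dst]; apply: pos_scaled_cat; last exact: IHst.
apply: pos_scaled_cat; last exact: pos_scaled_sign.
apply: (pos_scaled_allpairs _ _ rn0) => j s.
by rewrite pullB !(pullZ (sgn _)) !pull_score// scalerBr !scalerA !(mulrC rn).
Qed.

(** The previous knot is required to carry the same factor as the current ones, so that comparisons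
    with it scale too. *)
Lemma pos_scaled_path cross prevS prevX a banned st :
  match prevS, prevX with
  | Some lS, Some lX => pull lS = rn^-1 *: lX
  | None, None => True
  | _, _ => False
  end ->
  gram X (unzip1 a) \in unitmx -> path_defined DX cross a banned st ->
  pos_scaled (path_rows DS cross prevS a banned st)
    (path_rows DX cross prevX a banned st).
Proof.
elim: st prevS prevX a banned => [|q st IHst] prevS prevX a banned hprev ua /=.
  by move=> _; exact: pos_scaled_nil.
move=> [_ ub dst]; apply: pos_scaled_cat; last first.
  apply: pos_scaled_cat; first exact: pos_scaled_sign.
  by apply: IHst dst => //; exact: pull_knot.
apply: pos_scaled_cat.
  case: prevS prevX hprev => [lS|] [lX|] //= hl; last exact: pos_scaled_nil.
  apply: (pos_scaled_map _ rnV0) => e.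
  by case: ifP => _; rewrite pullB pull_knot// hl scalerBr.
apply: pos_scaled_cat.
  apply: (pos_scaled_map _ rnV0) => e.
  by rewrite pullB !pull_knot// scalerBr.
exact: pos_scaled_cons rnV0 (pull_knot _ ua) pos_scaled_nil.
Qed.

Lemma pos_scaled_model k (M : model d k) : model_defined DX M ->
  pos_scaled (model_rows DS M) (model_rows DX M).
Proof.
have u0 : gram X [::] \in unitmx by rewrite unitmxE det_mx00 unitr1.
case: M => st /=; first exact: pos_scaled_fs.
  exact: pos_scaled_path.
exact: pos_scaled_path.
Qed.

(** * The normalized direction in terms of the Gram matrix *)

Section Direction.
Variables (A : seq 'I_d) (j : 'I_d).
Hypothesis jA : j \in A.
Hypothesis uA : gram X A \in unitmx.

Let lev : R := ((bvec A j)^T *m invmx (gram X A) *m bvec A j) 0 0.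

Let inv_diagE : inv_diag A j S = n%:R * lev.
Proof. by rewrite /inv_diag invmx_subgram// -scalemxAr -scalemxAl mxE. Qed.

Let lev_gt0 : 0 < lev.
Proof.
apply: psd_inv_gt0 => //; last exact: bvec_neq0.
split=> [|u]; first exact: gram_sym.
have -> : dot u (gram X A *m u) = dot (cols X A *m u) (cols X A *m u).
  by rewrite /dot trmx_mul !mulmxA.
exact: dot_ge0.
Qed.

Let sqrt_inv_diagE : Num.sqrt (inv_diag A j S) = rn * Num.sqrt lev.
Proof. by rewrite inv_diagE sqrtrM// ltW. Qed.

Lemma norm2_coef_dir : norm2 (coef_dir X A j) = 1.
Proof.
rewrite /norm2 /coef_dir -/lev dotZZ.
have -> : dot (coef_vec X A j) (coef_vec X A j) = lev.
  rewrite /dot /coef_vec !trmx_mul trmx_inv gram_sym !mulmxA.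
  rewrite -[_ *m (cols X A)^T *m cols X A]mulmxA -/(gram X A).
  by rewrite -[_ *m gram X A]mulmxA mulVmx// mulmx1.
rewrite -invfM -expr2 sqr_sqrtr ?ltW// mulVf ?sqrtr1//.
by rewrite gt_eqF.
Qed.

Lemma pull_mulmx r (y : 'cV[R]_n) : r *m (rn^-1 *: (X^T *m y)) = pull r *m y.
Proof. by rewrite /pull -scalemxAr -scalemxAl mulmxA. Qed.

(** The factor [rn] of the coefficient cancels the one in the square root of [inv_diag]. *)
Lemma gram_projE (y : 'cV[R]_n) :
  gram_proj A j S (rn^-1 *: (X^T *m y)) = dot (coef_dir X A j) y.
Proof.
rewrite /gram_proj pull_mulmx pull_coef// sqrt_inv_diagE.
rewrite -scalemxAl mxE invfM mulrACA mulVf// mul1r.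
by rewrite /coef_dir -/lev -[y in RHS]scale1r dotZZ mulr1.
Qed.

Lemma gram_dirE : gram_dir A j S = rn^-1 *: (X^T *m coef_dir X A j).
Proof.
rewrite /gram_dir sqrt_inv_diagE /coef_dir -/lev -scalemxAr scalerA invfM.
rewrite -scalemxAl scalerA -mulmxA.
have -> : X *m (sd_coef DS A j)^T = n%:R *: coef_vec X A j.
  have E : sd_coef DS A j *m X^T = n%:R *: sd_coef DX A j.
    by rewrite -[in RHS]rnrn -[RHS]scalerA -pull_coef// scalerA divff// scale1r.
  by rewrite -[X in X *m _]trmxK -trmx_mul E linearZ/= trmxK.
by rewrite -scalemxAr scalerA divfK.
Qed.

End Direction.

Lemma TG_gram_pivot (A : seq 'I_d) (j : 'I_d) k (M : model d k) (mu sigma : R)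
    (y : 'cV[R]_n) : j \in A -> 0 < sigma -> model_defined DX M ->
  gram X A \in unitmx ->
  TG sigma X y M (coef_dir X A j) mu =
  gram_pivot A j M mu sigma^-1 S (rn^-1 *: (X^T *m y)).
Proof.
move=> jA sigma0 dM uA; rewrite TG_pivot//; last exact: norm2_coef_dir.
rewrite /gram_pivot gram_projE//; apply/esym.
have [sz sc] := pos_scaled_model dM.
apply: pivot_scale => [|i]; first by rewrite !size_map.
have [im|im] := ltnP i (size (model_rows DX M)); last first.
  (* Past the end both lists read the zero pair. *)
  by exists 1 => //; rewrite !nth_default ?size_map ?sz// !mul1r.
rewrite !(nth_map 0) ?sz//; have [c c0 ric] := sc i; exists c => //=.
by rewrite gram_dirE// !pull_mulmx ric -!scalemxAl !mxE.
Qed.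

End DesignToGram.

Theorem lemma4 (R : realType) (d k : nat) (hk : (0 < k)%N)
    (M : model d k) (hM : possible M)
    (mu sigma : R) (hsigma : 0 < sigma)
    (A : {set 'I_d}) (j : 'I_d) (hj : j \in A) :
  exists psi : 'M[R]_d -> 'cV[R]_d -> R,
    (forall (n : nat) (X : 'M[R]_(n, d)) (y : 'cV[R]_n),
        (0 < n)%N ->
        model_defined (design_data X) M ->
        gram X (enum A) \in unitmx ->
        selects M X y ->
        TG sigma X y M (coef_dir X (enum A) j) mu =
        psi (n%:R^-1 *: (X^T *m X)) ((Num.sqrt n%:R)^-1 *: (X^T *m y)))
    /\
    (forall (S : 'M[R]_d) (z : 'cV[R]_d),
        S^T = S ->
        (forall x : 'cV[R]_d, 0 <= dot x (S *m x)) ->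
        S \in unitmx ->
        model_defined (gram_data S) M ->
        (forall i, 0 < (Pmx M S *m z) i 0) ->
        {for (S, z), continuous (fun p : 'M[R]_d * 'cV[R]_d => psi p.1 p.2)}).
Proof.
have jA : j \in enum A by rewrite mem_enum.
exists (gram_pivot (enum A) j M mu sigma^-1); split=> [n X y n0 dM uA _|].
  exact: TG_gram_pivot.
move=> S z symS posS uS dM pos.
apply: cvg_gram_pivot => //; last by rewrite invr_gt0.
(* Matrix entries are continuous, so neighbourhoods of (S, z) in the product yield the entrywise
   limits. *)
- move=> i l; apply: (@cvg_comp _ _ _ fst (fun B : 'M[R]_d => B i l)).
    exact: cvg_fst.
  exact: coord_continuous.
- move=> i l; apply: (@cvg_comp _ _ _ snd (fun B : 'cV[R]_d => B i l)).
    exact: cvg_snd.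
  exact: coord_continuous.
- exact: enum_uniq.
Qed.
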